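(* Let $n,m\ge 1$, $q=n^2+nm$, let $\hat{A}\in\mathbb{R}^{n\times n}$, $\hat{B}\in\mathbb{R}^{n\times m}$ be known matrices, and let $H\in\mathbb{R}^{n\times q}$, $E\in\mathbb{R}^{q\times n}$, $F\in\mathbb{R}^{q\times m}$ be the uncertainty matrices defined in the context. Let $T_\mathrm{s}>0$. Suppose there exist matrices $Q_1=Q_1^{\mathsf T}\succ 0$, $Q_2$, $Q_3$, $Z_1$, $Z_2$, $Z_3$, $R=R^{\mathsf T}\succ 0$, all in $\mathbb{R}^{n\times n}$, a matrix $Y\in\mathbb{R}^{m\times n}$, and scalars $\epsilon_1>0$, $\epsilon_2>0$ satisfying the matrix inequalities $$ \begin{bmatrix} \Xi & \Xi_{\hat A,\hat B} & T_\mathrm{s}Q_2^{\mathsf T} & 0 & \epsilon_1\left(Q_1E^{\mathsf T}+Y^{\mathsf T}F^{\mathsf T}\right)\\ * & -Q_3-Q_3^{\mathsf T}+T_\mathrm{s}Z_3 & T_\mathrm{s}Q_3^{\mathsf T} & H & 0\\ * & * & -T_\mathrm{s}R & 0 & 0\\ * & * & * & -\epsilon_1 I & 0\\ * & * & * & * & -\epsilon_1 I \end{bmatrix}\prec 0, $$ $$ \begin{bmatrix} 2Q_1-R & 0 & Y^{\mathsf T}\hat B^{\mathsf T} & 0 & \epsilon_2Y^{\mathsf T}F^{\mathsf T}\\ * & Z_1 & Z_2 & 0 & 0\\ * & * & Z_3 & H & 0\\ * & * & * & \epsilon_2 I & 0\\ * & * & * & * & \epsilon_2 I \end{bmatrix}\succeq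 0, $$ where $\Xi=Q_2+Q_2^{\mathsf T}+T_\mathrm{s}Z_1$ and $\Xi_{\hat A,\hat B}=Q_3-Q_2^{\mathsf T}+Q_1\hat A^{\mathsf T}+T_\mathrm{s}Z_2+Y^{\mathsf T}\hat B^{\mathsf T}$. Then, with the state-feedback gain $K=YQ_1^{-1}$, the uncertain sampled-data closed-loop system $$ \dot{\tilde x}(t)=\big(\hat A+H\Delta E\big)\tilde x(t)+\big(\hat B+H\Delta F\big)K\,\tilde x(t-\tau(t)),\qquad \tau(t)=t-t_k\ \text{ for } t\in[t_k,t_{k+1}),\ k\in\mathbb{N}_0, $$ is robustly asymptotically stable for all sampling sequences $(t_k)_{k\in\mathbb{N}_0}$ satisfying $t_{k+1}-t_k\le T_\mathrm{s}$ for all $k\in\mathbb{N}_0$.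
   Context: In symmetric block matrices, $*$ denotes the block determined by symmetry (the transpose of the corresponding block above the diagonal); the two displayed block matrices are required to be symmetric, and $\prec 0$ / $\succeq 0$ mean negative definite / positive semidefinite. $I$ and $0$ are identity and zero matrices of compatible size. Uncertainty matrices. Let $\bar A\in\mathbb{R}^{n\times n}$ and $\bar B\in\mathbb{R}^{n\times m}$ be known matrices with nonnegative entries, with rows $\bar a_1^{\mathsf T},\dots,\bar a_n^{\mathsf T}$ and $\bar b_1^{\mathsf T},\dots,\bar b_n^{\mathsf T}$ respectively. For a vector $a$, $\mathrm{Diag}(a)$ is the diagonal matrix with the entries of $a$ on its diagonal; $\otimes$ is the Kronecker product; $\mathbf 1_{1\times k}$ is the all-ones row vector. Define $$H=\big[\,I_n\otimes \mathbf 1_{1\times n},\ I_n\otimes\mathbf 1_{1\times m}\,\big],$$ $$E=\big[\,\mathrm{Diag}(\bar a_1)\ \cdots\ \mathrm{Diag}(\bar a_n)\ \ 0_{n\times nm}\,\big]^{\mathsf T},\qquad F=\big[\,0_{m\times n^2}\ \ \mathrm{Diag}(\bar b_1)\ \cdots\ \mathrm{Diag}(\bar b_n)\,\big]^{\mathsf T}.$$ The unknown matrix is $\Delta=\mathrm{Diag}([\delta_1,\dots,\delta_q])\in\mathbb{R}^{q\times q}$ with constant $\delta_i$, $|\delta_i|\le 1$ for all $i$. Sampling. The sampling instants satisfy $t_0=0$, are strictly increasing and tend to infinity (so that the control is defined for all $t\ge 0$); sampling may be periodic or aperiodic. The closed-loop system arises from $\dot{\tilde x}(t)=(\hat A+H\Delta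 E)\tilde x(t)+(\hat B+H\Delta F)\tilde u(t)$ under the zero-order-hold control $\tilde u(t)=K\tilde x(t_k)$ for $t\in[t_k,t_{k+1})$, with arbitrary initial state $\tilde x(0)\in\mathbb{R}^n$. ''Robustly asymptotically stable'' means that for every admissible $\Delta$ (diagonal, $|\delta_i|\le 1$) the zero solution of the closed-loop system is asymptotically stable. *)

(* Defs.v *)
From HB Require Import structures.
From mathcomp Require Import all_boot all_order all_algebra.
From mathcomp Require Import all_classical all_reals all_analysis.
From mathcomp Require Import mxtens.

Set Implicit Arguments.
Unset Strict Implicit.
Unset Printing Implicit Defensive.

Import Order.TTheory GRing.Theory Num.Theory.
Import numFieldNormedType.Exports.

Local Open Scope classical_set_scope.
Local Open Scope ring_scope.

(* As usual for matrix inequalities, definiteness includes symmetry. *)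
Definition posdefmx (R : realType) (k : nat) (M : 'M[R]_k) : Prop :=
  M^T = M /\ forall v : 'cV[R]_k, v != 0 -> 0 < (v^T *m M *m v) 0 0.

Definition negdefmx (R : realType) (k : nat) (M : 'M[R]_k) : Prop :=
  M^T = M /\ forall v : 'cV[R]_k, v != 0 -> (v^T *m M *m v) 0 0 < 0.

Definition possemidefmx (R : realType) (k : nat) (M : 'M[R]_k) : Prop :=
  M^T = M /\ forall v : 'cV[R]_k, 0 <= (v^T *m M *m v) 0 0.

(* [A B; * D]. Right-nested uses of symblock, with row_mx for B, spell out the
   on- and above-diagonal part of a symmetric block matrix. The diagonal blocks
   A and D need not be symmetric: this is what the symmetry clause in the
   definiteness predicates is for. *)
Definition symblock (R : realType) (k l : nat)
    (A : 'M[R]_k) (B : 'M[R]_(k, l)) (D : 'M[R]_l) : 'M[R]_(k + l) :=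
  block_mx A B B^T D.

Lemma sum_ord_const (n k : nat) : (\sum_(i < n) k = n * k)%N.
Proof. by rewrite sum_nat_const card_ord. Qed.

(* [Diag(a_1) ... Diag(a_n)], where a_i^T is the i-th row of A. *)
Definition diag_rows (R : realType) (n k : nat) (A : 'M[R]_(n, k)) :
    'M[R]_(k, n * k) :=
  castmx (erefl k, sum_ord_const n k) (\mxrow_(i < n) diag_mx (row i A)).

(* I_n (x) 1_{1 x k}; the cast turns its n * 1 rows into n rows. *)
Definition id_tens_ones (R : realType) (n k : nat) : 'M[R]_(n, n * k) :=
  castmx (muln1 n, erefl (n * k)%N)
    ((1%:M : 'M[R]_n) *t (const_mx 1 : 'M[R]_(1, k))).

Definition uncH (R : realType) (n m : nat) : 'M[R]_(n, n * n + n * m) :=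
  row_mx (id_tens_ones R n n) (id_tens_ones R n m).

Definition uncE (R : realType) (n m : nat) (Abar : 'M[R]_n) :
    'M[R]_(n * n + n * m, n) :=
  (row_mx (diag_rows Abar) (0 : 'M[R]_(n, n * m)))^T.

Definition uncF (R : realType) (n m : nat) (Bbar : 'M[R]_(n, m)) :
    'M[R]_(n * n + n * m, m) :=
  (row_mx (0 : 'M[R]_(m, n * n)) (diag_rows Bbar))^T.

Definition lmi1 (R : realType) (n m q : nat) (Ahat : 'M[R]_n)
    (Bhat : 'M[R]_(n, m)) (H : 'M[R]_(n, q)) (E : 'M[R]_(q, n))
    (F : 'M[R]_(q, m)) (Ts : R) (Q1 Q2 Q3 Z1 Z2 Z3 Rm : 'M[R]_n)
    (Y : 'M[R]_(m, n)) (eps1 : R) : 'M[R]_(n + (n + (n + (q + q)))) :=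
  let Xi := Q2 + Q2^T + Ts *: Z1 in
  let XiAB := Q3 - Q2^T + Q1 *m Ahat^T + Ts *: Z2 + Y^T *m Bhat^T in
  symblock Xi
    (row_mx XiAB (row_mx (Ts *: Q2^T)
      (row_mx 0 (eps1 *: (Q1 *m E^T + Y^T *m F^T)))))
  (symblock (- Q3 - Q3^T + Ts *: Z3)
    (row_mx (Ts *: Q3^T) (row_mx H 0))
  (symblock (- (Ts *: Rm))
    (row_mx 0 0)
  (symblock (- eps1%:M)
    0
    (- eps1%:M)))).

Definition lmi2 (R : realType) (n m q : nat)
    (Bhat : 'M[R]_(n, m)) (H : 'M[R]_(n, q)) (F : 'M[R]_(q, m))
    (Q1 Z1 Z2 Z3 Rm : 'M[R]_n) (Y : 'M[R]_(m, n)) (eps2 : R) :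
    'M[R]_(n + (n + (n + (q + q)))) :=
  symblock (2 *: Q1 - Rm)
    (row_mx 0 (row_mx (Y^T *m Bhat^T) (row_mx 0 (eps2 *: (Y^T *m F^T)))))
  (symblock Z1
    (row_mx Z2 (row_mx 0 0))
  (symblock Z3
    (row_mx H 0)
  (symblock eps2%:M
    0
    eps2%:M))).

Definition sampling_sequence (R : realType) (t : nat -> R) : Prop :=
  [/\ t 0%N = 0, forall k, t k < t k.+1 & t k @[k --> \oo] --> +oo].

(* Solutions on [0, +oo[ of x'(s) = A x(s) + Ad x(s - tau(s)), with
   tau(s) = s - t_k on [t_k, t_{k+1}[. At a sampling instant the solution is
   only required to be continuous: the right-hand side jumps there, and the
   equation for the right derivative follows by continuity. Values of x at
   negative times are irrelevant. *)
Definition sampled_solution (R : realType) (n : nat) (A Ad : 'M[R]_n)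
    (t : nat -> R) (x : R -> 'cV[R]_n) : Prop :=
  {within `[0, +oo[, continuous x} /\
  forall (k : nat) (s : R), t k < s -> s < t k.+1 ->
    let tau := s - t k in
    is_derive s 1 x (A *m x s + Ad *m x (s - tau)).

(* Lyapunov stability of the zero solution, and attraction of the solutions
   issued from every initial state; |.| is the max norm. *)
Definition asymptotically_stable (R : realType) (n : nat)
    (sol : (R -> 'cV[R]_n) -> Prop) : Prop :=
  (forall e : R, 0 < e -> exists2 d : R, 0 < d &
     forall x, sol x -> `|x 0| < d -> forall s : R, 0 <= s -> `|x s| < e) /\
  (forall x, sol x -> x s @[s --> +oo] --> (0 : 'cV[R]_n)).

Definition robustly_asymptotically_stable (R : realType) (n m q : nat)
    (Ahat : 'M[R]_n) (Bhat : 'M[R]_(n, m)) (H : 'M[R]_(n, q))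
    (E : 'M[R]_(q, n)) (F : 'M[R]_(q, m)) (K : 'M[R]_(m, n))
    (t : nat -> R) : Prop :=
  forall delta : 'rV[R]_q, (forall i, `|delta 0 i| <= 1) ->
    let Delta := diag_mx delta in
    asymptotically_stable
      (sampled_solution (Ahat + H *m Delta *m E)
         ((Bhat + H *m Delta *m F) *m K) t).

(* Main.v *)
(** With P = Q1^-1 and S = R^-1, put u = P x and choose w so that
    y = Q2 u + Q3 w, where y is the velocity. The first inequality, evaluated
    at (u, w, S y, Delta G u, G u) with G = E Q1 + F Y, and the second one,
    evaluated at (P z, u, w, Delta F Y P z, - F Y P z), bound the derivative of
    x^T P x in terms of y^T S y and z^T S z, where x - x(t_k) = sigma z.
    Strictness of the first inequality leaves some slack eps.

    On [t_k, t_{k+1}] the function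
      V = x^T P x + lambda (T / sigma - 1) (x - x(t_k))^T S (x - x(t_k)),
      sigma = s - t_k + delta, T = Ts + delta,
    then satisfies V' <= - rate V. It replaces the usual functional with the
    integral of y^T S y over [t_k, s]: by Jensen's inequality only the increment
    of x matters. The shift delta > 0, paid for by eps, keeps V smooth at t_k.
    Since V = x^T P x at t_k and V >= x^T P x on the interval, x^T P x decays
    exponentially. *)
Require Import Defs.
From HB Require Import structures.
From mathcomp Require Import all_boot all_order all_algebra.
From mathcomp Require Import all_classical all_reals all_analysis.
From mathcomp Require Import ring lra.

Set Implicit Arguments.
Unset Strict Implicit.
Unset Printing Implicit Defensive.

Import Order.TTheory GRing.Theory Num.Theory.
Import numFieldNormedType.Exports.

Local Open Scope classical_set_scope.
Local Open Scope ring_scope.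

(** * Inner products, quadratic forms and definite matrices *)

Section InnerProduct.
Variable R : realType.

Definition ip k (u v : 'cV[R]_k) : R := (u^T *m v) 0 0.

Lemma ipE k (u v : 'cV[R]_k) : ip u v = \sum_i u i 0 * v i 0.
Proof. by rewrite /ip mxE; apply: eq_bigr => i _; rewrite mxE. Qed.

Lemma ipC k (u v : 'cV[R]_k) : ip u v = ip v u.
Proof. by rewrite !ipE; apply: eq_bigr => i _; rewrite mulrC. Qed.

Lemma ipDr k (u v w : 'cV[R]_k) : ip u (v + w) = ip u v + ip u w.
Proof. by rewrite /ip mulmxDr mxE. Qed.

Lemma ipDl k (u v w : 'cV[R]_k) : ip (v + w) u = ip v u + ip w u.
Proof. by rewrite ipC ipDr !(ipC u). Qed.

Lemma ipZr k c (u v : 'cV[R]_k) : ip u (c *: v) = c * ip u v.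
Proof. by rewrite /ip -scalemxAr mxE. Qed.

Lemma ipZl k c (u v : 'cV[R]_k) : ip (c *: u) v = c * ip u v.
Proof. by rewrite ipC ipZr ipC. Qed.

Lemma ipNr k (u v : 'cV[R]_k) : ip u (- v) = - ip u v.
Proof. by rewrite -scaleN1r ipZr mulN1r. Qed.

Lemma ipNl k (u v : 'cV[R]_k) : ip (- u) v = - ip u v.
Proof. by rewrite ipC ipNr ipC. Qed.

Lemma ip0r k (u : 'cV[R]_k) : ip u 0 = 0.
Proof. by rewrite -(scale0r 0) ipZr mul0r. Qed.

Lemma ip0l k (u : 'cV[R]_k) : ip 0 u = 0.
Proof. by rewrite ipC ip0r. Qed.

Lemma ip_trmx k l (A : 'M[R]_(k, l)) u v : ip v (A^T *m u) = ip u (A *m v).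
Proof. by rewrite ipC /ip trmx_mul trmxK mulmxA. Qed.

Lemma ip_trmxl k l (A : 'M[R]_(k, l)) u v : ip (A^T *m u) v = ip u (A *m v).
Proof. by rewrite ipC ip_trmx. Qed.

Lemma ip_sym k (A : 'M[R]_k) u v : A^T = A -> ip u (A *m v) = ip v (A *m u).
Proof. by move=> sA; rewrite -{1}sA ip_trmx. Qed.

Lemma ip_col_mx k l (u u' : 'cV[R]_k) (v v' : 'cV[R]_l) :
  ip (col_mx u v) (col_mx u' v') = ip u u' + ip v v'.
Proof. by rewrite /ip tr_col_mx mul_row_col mxE. Qed.

Lemma ip_symblock k l (A : 'M[R]_k) (B : 'M[R]_(k, l)) D u v :
  ip (col_mx u v) (symblock A B D *m col_mx u v)
    = ip u (A *m u) + 2 * ip u (B *m v) + ip v (D *m v).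
Proof.
rewrite /symblock mul_block_col ip_col_mx !ipDr ip_trmx; ring.
Qed.

(** This is how the bound on the uncertainty enters both matrix inequalities: [Delta] is a
    contraction. *)
Lemma ip_diag_le k (d : 'rV[R]_k) (u : 'cV[R]_k) :
  (forall i, `|d 0 i| <= 1) -> ip (diag_mx d *m u) (diag_mx d *m u) <= ip u u.
Proof.
move=> d1; rewrite !ipE; apply: ler_sum => i _; rewrite mul_diag_mx mxE.
rewrite -!expr2 exprMn ler_piMl ?sqr_ge0// -real_normK ?num_real//.
by rewrite expr_le1.
Qed.

Lemma posdefmx_ge0 k (M : 'M[R]_k) v : posdefmx M -> 0 <= ip v (M *m v).
Proof.
move=> [_ pM]; have [->|/pM/ltW] := eqVneq v 0; first by rewrite ip0l.
by rewrite /ip mulmxA.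
Qed.

Lemma posdefmx_gt0 k (M : 'M[R]_k) v :
  posdefmx M -> v != 0 -> 0 < ip v (M *m v).
Proof. by move=> [_ pM] /pM; rewrite /ip mulmxA. Qed.

(** [kermx] is a kernel of row vectors, hence the passage to the transpose. *)
Lemma unitmx_of_inj k (M : 'M[R]_k) :
  (forall v : 'cV[R]_k, M *m v = 0 -> v = 0) -> M \in unitmx.
Proof.
move=> kM; rewrite -unitmx_tr -row_free_unit -kermx_eq0.
apply/rowV0P => u /sub_kermxP uM.
apply: trmx_inj; rewrite trmx0; apply: kM.
by rewrite -[M]trmxK -trmx_mul uM trmx0.
Qed.

Lemma posdefmx_unit k (M : 'M[R]_k) : posdefmx M -> M \in unitmx.
Proof.
move=> pM; apply: unitmx_of_inj => v Mv0; apply/eqP/negPn/negP => v0.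
by have := posdefmx_gt0 pM v0; rewrite Mv0 ip0r ltxx.
Qed.

Lemma posdefmx_inv k (M : 'M[R]_k) : posdefmx M -> posdefmx (invmx M).
Proof.
move=> pM; have uM := posdefmx_unit pM; have sM := pM.1.
have sV : (invmx M)^T = invmx M by rewrite trmx_inv sM.
split=> // v v0; rewrite -mulmxA -/(ip _ _) -{1}(mulKVmx uM v).
rewrite ipC -/(ip _ _) posdefmx_gt0//.
by apply: contra v0 => /eqP v0; rewrite -(mulKVmx uM v) v0 mulmx0.
Qed.

(* Cauchy-Schwarz for the form M, applied to M^-1 e_i and v. *)
Lemma posdefmx_coord k (M : 'M[R]_k) : posdefmx M ->
  exists2 C, 0 < C & forall (v : 'cV[R]_k) i, v i 0 ^+ 2 <= C * ip v (M *m v).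
Proof.
move=> pM; have uM := posdefmx_unit pM.
pose a i := invmx M *m (delta_mx i 0 : 'cV[R]_k).
pose c i := ip (a i) (M *m a i).
have c0 i : 0 <= c i by exact: posdefmx_ge0.
(* The sum serves every index at once; the added 1 keeps the constant positive even for [k = 0]. *)
exists (1 + \sum_i c i).
  by rewrite ltr_pwDl// sumr_ge0.
move=> v i; set q := ip v _.
have q0 : 0 <= q by exact: posdefmx_ge0.
suff h : v i 0 ^+ 2 <= c i * q.
  apply: (le_trans h); rewrite ler_wpM2r// (bigD1 i)//=.
  by rewrite addrCA lerDl addr_ge0// sumr_ge0.
have cE : c i = a i i 0.
  rewrite /c mulmxA mulmxV// mul1mx ipC ipE (bigD1 i)//= big1 ?addr0.
    by rewrite mxE !eqxx mul1r.
  by move=> j ji; rewrite mxE (negPf ji) mul0r.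
have vE : v i 0 = ip v (M *m a i).
  rewrite mulmxA mulmxV// mul1mx ipE (bigD1 i)//= big1 ?addr0.
    by rewrite mxE !eqxx mulr1.
  by move=> j ji; rewrite mxE (negPf ji) mulr0.
(* The form is nonnegative along the line [v + t *: a i]; the values of [t] chosen below extract the
   discriminant bound. *)
have quad t : 0 <= q + 2 * t * v i 0 + t ^+ 2 * c i.
  have := posdefmx_ge0 (v + t *: a i) pM.
  rewrite mulmxDr -scalemxAr !(ipDl, ipDr, ipZl, ipZr) -/q -/(c i).
  rewrite (ip_sym (a i) v pM.1) -vE => h; apply: (le_trans h).
  by rewrite le_eqVlt; apply/orP; left; apply/eqP; ring.
have [ci0|ci0] := eqVneq (c i) 0.
  (* The quadratic is now affine in [t], and this [t] gives it the value -1 unless [v i 0 = 0]. *)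
  have := quad (- ((q + 1) / (2 * v i 0))).
  have [->|vi0] := eqVneq (v i 0) 0; first by rewrite expr0n/= mulr_ge0.
  rewrite ci0 mulr0 addr0 => h; exfalso; move: h.
  rewrite (_ : q + _ = - 1); last by field.
  by rewrite lerNr oppr0 ler10.
have cp : 0 < c i by rewrite lt_neqAle eq_sym ci0 c0.
have := quad (- (v i 0 / c i)).
rewrite -(pmulr_rge0 _ cp) => h; rewrite -subr_ge0; apply: (le_trans h).
by rewrite le_eqVlt; apply/orP; left; apply/eqP; field.
Qed.

(** Each product of two coordinates is at most the mean of their squares, which [posdefmx_coord]
    controls. This replaces compactness of the unit sphere. *)
Lemma posdefmx_dominates k (M N : 'M[R]_k) : posdefmx M ->
  exists2 C, 0 < C & forall v : 'cV[R]_k, ip v (N *m v) <= C * ip v (M *m v).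
Proof.
move=> pM; have [C C0 hC] := posdefmx_coord pM.
pose S := \sum_i \sum_j `|N i j|.
have S0 : 0 <= S by do 2!(apply: sumr_ge0 => ? _).
exists (1 + S * C); first by rewrite ltr_pwDl// mulr_ge0// ltW.
move=> v; have q0 := posdefmx_ge0 v pM.
rewrite mulrDl mul1r ler_wpDl// -mulrA mulr_suml ipE ler_sum// => i _.
rewrite mxE mulr_sumr mulr_suml ler_sum// => j _.
apply: (le_trans (ler_norm _)); rewrite mulrCA normrM ler_wpM2l//.
have h : `|v i 0 * v j 0| <= (v i 0 ^+ 2 + v j 0 ^+ 2) / 2.
  rewrite ler_norml; apply/andP; split.
    have := sqr_ge0 (v i 0 + v j 0); lra.
  have := sqr_ge0 (v i 0 - v j 0); lra.
apply: (le_trans h); have := hC v i; have := hC v j; lra.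
Qed.

(** Turns strict negativity into a quantitative margin: [- M] dominates any [N], and the inverse of
    that constant is the slack. *)
Lemma negdefmx_robust k (M N : 'M[R]_k) : negdefmx M ->
  exists2 eps, 0 < eps &
    forall v : 'cV[R]_k, ip v (M *m v) <= - (eps * ip v (N *m v)).
Proof.
move=> [sM nM]; have pM : posdefmx (- M).
  split=> [|v /nM h]; first by rewrite linearN/= sM.
  by rewrite mulmxN mulNmx mxE oppr_gt0.
have [C C0 hC] := posdefmx_dominates N pM.
exists C^-1; rewrite ?invr_gt0// => v; have := hC v.
by rewrite mulNmx ipNr lerNr ler_pdivrMl.
Qed.

End InnerProduct.

(** * The matrix inequalities as quadratic forms, and the dissipation inequality *)

Section MatrixInequalities.
Variables (R : realType) (n m q : nat).
Variables (Ahat : 'M[R]_n) (Bhat : 'M[R]_(n, m)).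
Variables (H : 'M[R]_(n, q)) (E : 'M[R]_(q, n)) (F : 'M[R]_(q, m)).
Variables (Ts : R) (Q1 Q2 Q3 Z1 Z2 Z3 Rm : 'M[R]_n) (Y : 'M[R]_(m, n)).

(** The form of the block matrix [Z1 Z2; * Z3], which couples the two matrix inequalities. *)
Definition Zform (u w : 'cV[R]_n) : R :=
  ip u (Z1 *m u) + 2 * ip u (Z2 *m w) + ip w (Z3 *m w).

(** [Q2] and [Q3] enter only through [y], which can therefore be prescribed as the velocity. *)
Lemma lmi1_form eps u w v (p r : 'cV[R]_q) : Q1^T = Q1 ->
  let s := col_mx u (col_mx w (col_mx v (col_mx p r))) in
  let y := Q2 *m u + Q3 *m w in
  ip s (lmi1 Ahat Bhat H E F Ts Q1 Q2 Q3 Z1 Z2 Z3 Rm Y eps *m s)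
  = 2 * ip u y - 2 * ip w y + 2 * ip w (Ahat *m (Q1 *m u) + Bhat *m (Y *m u))
    + Ts * Zform u w + 2 * Ts * ip v y - Ts * ip v (Rm *m v)
    + 2 * ip w (H *m p) + 2 * eps * ip r (E *m (Q1 *m u) + F *m (Y *m u))
    - eps * ip p p - eps * ip r r.
Proof.
move=> sQ1 s y; rewrite /s /y /Zform /lmi1 !ip_symblock !mul_row_col.
rewrite !(mulmxDl, mulmxDr, mulNmx, mul0mx, =^~ scalemxAl, mul_scalar_mx).
rewrite -!mulmxA !(ipDr, ipNr, ipZr, ip0r) !ip_trmx.
rewrite (ip_sym u _ sQ1) (ip_sym u (E^T *m r) sQ1).
rewrite !ip_trmxl.
ring.
Qed.

Lemma lmi2_form eps z u w (p r : 'cV[R]_q) :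
  let s := col_mx z (col_mx u (col_mx w (col_mx p r))) in
  ip s (lmi2 Bhat H F Q1 Z1 Z2 Z3 Rm Y eps *m s)
  = 2 * ip z (Q1 *m z) - ip z (Rm *m z) + 2 * ip w (Bhat *m (Y *m z))
    + Zform u w + 2 * ip w (H *m p) + 2 * eps * ip r (F *m (Y *m z))
    + eps * ip p p + eps * ip r r.
Proof.
move=> s; rewrite /s /Zform /lmi2 !ip_symblock !mul_row_col.
rewrite !(mulmxDl, mulmxDr, mulNmx, mul0mx, =^~ scalemxAl, mul_scalar_mx).
rewrite -!mulmxA !(ipDr, ipNr, ipZr, ip0r) !ip_trmx.
rewrite !(ip_trmxl, ip_trmx).
ring.
Qed.

Variables eps1 eps2 : R.
Hypothesis (Ts_gt0 : 0 < Ts) (eps1_gt0 : 0 < eps1) (eps2_gt0 : 0 < eps2).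
Hypothesis (pQ1 : posdefmx Q1) (pRm : posdefmx Rm).
Hypothesis hlmi1 :
  negdefmx (lmi1 Ahat Bhat H E F Ts Q1 Q2 Q3 Z1 Z2 Z3 Rm Y eps1).
Hypothesis hlmi2 :
  possemidefmx (lmi2 Bhat H F Q1 Z1 Z2 Z3 Rm Y eps2).

Lemma Zform_ge0 u w : 0 <= Zform u w.
Proof.
have := hlmi2.2 (col_mx 0 (col_mx u (col_mx w (col_mx 0 0)))).
rewrite -mulmxA -/(ip _ _) lmi2_form !mulmx0 !(ip0l, ip0r) !mulr0.
by rewrite subr0 !addr0 add0r.
Qed.

(** If [Q3 *m w = 0], the first form at (0, w, 0, 0, 0) reduces to [Ts * Zform 0 w], which is
    nonnegative. Invertibility is what allows solving y = Q2 u + Q3 w for w. *)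
Lemma Q3_unitmx : Q3 \in unitmx.
Proof.
apply: unitmx_of_inj => w Q3w; apply/eqP/negPn/negP => w0.
have : col_mx 0 (col_mx w (col_mx 0 (col_mx (0 : 'cV_q) (0 : 'cV_q)))) != 0
    :> 'cV[R]_(n + (n + (n + (q + q)))).
  by rewrite !col_mx_eq0 (negPf w0) andbF.
move=> /hlmi1.2; rewrite -mulmxA -/(ip _ _) lmi1_form ?pQ1.1//.
rewrite Q3w !mulmx0 !addr0 !(ip0l, ip0r, mulmx0) !mulr0 !(addr0, subr0, add0r).
by rewrite ltNge mulr_ge0 ?Zform_ge0// ltW.
Qed.

Lemma lmi1_robust : exists2 eps, 0 < eps &
  forall delta : 'rV[R]_q, (forall i, `|delta 0 i| <= 1) ->
  forall u w v y : 'cV[R]_n, y = Q2 *m u + Q3 *m w ->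
  2 * ip u y - 2 * ip w y
    + 2 * ip w ((Ahat + H *m diag_mx delta *m E) *m (Q1 *m u)
                + (Bhat + H *m diag_mx delta *m F) *m (Y *m u))
    + Ts * Zform u w + 2 * Ts * ip v y - Ts * ip v (Rm *m v)
  <= - (eps * (Zform u w + ip u (Q1 *m u) + ip v (Rm *m v))).
Proof.
(* [N] selects the terms that need slack: [Zform] and [Rm] to replace [Ts] by [Ts + eps], and [Q1]
   for the decay of x^T P x. *)
pose N : 'M[R]_(n + (n + (n + (q + q)))) :=
  symblock (Z1 + Q1) (row_mx Z2 0) (symblock Z3 0 (symblock Rm 0 0)).
have [eps eps0 hN] := negdefmx_robust N hlmi1.
exists eps => // delta d1 u w v y yE.
pose G := E *m (Q1 *m u) + F *m (Y *m u).
pose p := diag_mx delta *m G.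
have := hN (col_mx u (col_mx w (col_mx v (col_mx p G)))).
have -> : ip (col_mx u (col_mx w (col_mx v (col_mx p G))))
    (N *m col_mx u (col_mx w (col_mx v (col_mx p G))))
    = Zform u w + ip u (Q1 *m u) + ip v (Rm *m v).
  rewrite !ip_symblock !mul_row_col !mul0mx !addr0 !ip0r mulmxDl ipDr /Zform.
  ring.
move=> h; apply: (le_trans _ h) => {h}; rewrite lmi1_form ?pQ1.1// -/G -yE.
have -> : (Ahat + H *m diag_mx delta *m E) *m (Q1 *m u)
    + (Bhat + H *m diag_mx delta *m F) *m (Y *m u)
    = Ahat *m (Q1 *m u) + Bhat *m (Y *m u) + H *m p.
  by rewrite /p /G !(mulmxDl, mulmxDr) -!mulmxA addrACA.
have := ip_diag_le G d1; rewrite -/p [ip w (_ + H *m p)]ipDr.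
by rewrite -(ler_pM2l eps1_gt0) => h; lra.
Qed.

Lemma lmi2_robust (delta : 'rV[R]_q) (z u w : 'cV[R]_n) :
  (forall i, `|delta 0 i| <= 1) ->
  0 <= 2 * ip z (Q1 *m z) - ip z (Rm *m z)
       + 2 * ip w ((Bhat + H *m diag_mx delta *m F) *m (Y *m z)) + Zform u w.
Proof.
move=> d1; pose G := F *m (Y *m z); pose p := diag_mx delta *m G.
(* The sign of [- G] makes the [eps2] terms add up to eps2 (p^T p - G^T G) <= 0, as an inequality in
   the opposite direction requires. *)
have := hlmi2.2 (col_mx z (col_mx u (col_mx w (col_mx p (- G))))).
rewrite -mulmxA -/(ip _ _) lmi2_form -/G => h.
apply: (le_trans h).
have -> : (Bhat + H *m diag_mx delta *m F) *m (Y *m z)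
    = Bhat *m (Y *m z) + H *m p.
  by rewrite /p /G !mulmxDl -!mulmxA.
have := ip_diag_le G d1; rewrite -/p ipDr !(ipNl, ipNr) -(ler_pM2l eps2_gt0).
by move=> hp; lra.
Qed.

Let P := invmx Q1.
Let S := invmx Rm.

(* Q1 S Q1 >= 2 Q1 - R, because (R a - z)^T S (R a - z) >= 0 for a = P z. *)
Lemma posdefmx_young (z : 'cV[R]_n) :
  2 * ip (P *m z) (Q1 *m (P *m z)) - ip (P *m z) (Rm *m (P *m z))
    <= ip z (S *m z).
Proof.
have uQ := posdefmx_unit pQ1; have uR := posdefmx_unit pRm.
rewrite mulKVmx//; set a := P *m z.
have := posdefmx_ge0 (Rm *m a - z) (posdefmx_inv pRm).
rewrite mulmxBr mulKmx// !(ipDl, ipDr, ipNl, ipNr) -/S.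
rewrite (ip_sym (Rm *m a) z (posdefmx_inv pRm).1) -/S mulKmx//.
rewrite (ipC z a) (ipC (Rm *m a) a); lra.
Qed.

Lemma dissipation : exists2 eps, 0 < eps &
  forall delta : 'rV[R]_q, (forall i, `|delta 0 i| <= 1) ->
  forall (x y z : 'cV[R]_n) sigma, 0 <= sigma <= Ts + eps ->
  y = (Ahat + H *m diag_mx delta *m E) *m x
    + (Bhat + H *m diag_mx delta *m F) *m (Y *m P) *m (x - sigma *: z) ->
  2 * ip x (P *m y) + (Ts + eps) * ip y (S *m y) + eps * ip x (P *m x)
    <= sigma * ip z (S *m z).
Proof.
have [eps eps0 hrob] := lmi1_robust; exists eps => // delta d1 x y z sigma.
move=> /andP[sigma0 sigmaT].
set A := Ahat + _; set B := Bhat + _ => yE.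
have uQ := posdefmx_unit pQ1; have uR := posdefmx_unit pRm.
have sP : P^T = P := (posdefmx_inv pQ1).1.
have sS : S^T = S := (posdefmx_inv pRm).1.
pose u := P *m x; pose w := invmx Q3 *m (y - Q2 *m u).
have yw : y = Q2 *m u + Q3 *m w by rewrite /w mulKVmx ?Q3_unitmx// subrKC.
(* [v = S *m y] maximises 2 v^T y - v^T Rm v, with value y^T S y. *)
have := hrob delta d1 u w (S *m y) y yw; rewrite -/A -/B.
rewrite (mulKVmx uQ) (mulKVmx uR).
have := lmi2_robust (P *m z) u w d1; rewrite -/B.
have := posdefmx_young z.
have := Zform_ge0 u w.
(* The part [y] cancels against - 2 w^T y; only the sampling error, of size [sigma], is left for the
   second inequality. *)
have -> : A *m x + B *m (Y *m u) = y + sigma *: (B *m (Y *m (P *m z))).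
  rewrite yE /u -!mulmxA mulmxBr -scalemxAr !mulmxBr -!scalemxAr.
  by rewrite addrA subrK.
rewrite (ip_sym x y sP) -/u (ipC y u) (ipC u x) (ipC (S *m y) y).
rewrite ipDr ipZr.
set Zf := Zform u w; set b := ip w (B *m _); set yy := ip y (S *m y).
set zz := ip z (S *m z); set a := 2 * ip (P *m z) _ - _.
move=> Z0 ya lm2 lm1.
have := ler_wpM2l sigma0 (le_trans lm2 (lerD (lerD ya (lexx _)) (lexx _))).
rewrite mulr0 2!mulrDr => h.
(* The second inequality was scaled by [sigma], so it costs [sigma * Zf]; the first one provides
   [(Ts + eps) * Zf]. *)
have := ler_wpM2r Z0 sigmaT; lra.
Qed.

End MatrixInequalities.

(** * Derivatives and limits of bilinear forms, and the max norm *)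

Section Calculus.
Variable R : realType.

Lemma ip_mulmxE k (M : 'M[R]_k) (u v : 'cV[R]_k) :
  ip u (M *m v) = \sum_i u i 0 * (\sum_j M i j * v j 0).
Proof. by rewrite ipE; apply: eq_bigr => i _; rewrite mxE. Qed.

Lemma is_derive_coord k (u : R -> 'cV[R]_k) (s : R) du i :
  is_derive s 1 u du -> is_derive s 1 (fun r => u r i 0) (du i 0).
Proof.
move=> [/[dup] dvu /derivable_mxP du_ <-]; apply: DeriveDef => //.
by rewrite derive_mx// mxE.
Qed.

Lemma is_derive_ip_mulmx k (M : 'M[R]_k) (u v : R -> 'cV[R]_k) (s : R) du dv :
  is_derive s 1 u du -> is_derive s 1 v dv ->
  is_derive s 1 (fun r => ip (u r) (M *m v r))
    (ip du (M *m v s) + ip (u s) (M *m dv)).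
Proof.
move=> hu hv.
have -> : (fun r => ip (u r) (M *m v r)) = \sum_i
    ((fun r => u r i 0) * (\sum_j (M i j \*: (fun r => v r j 0))))%R.
  apply/funext => r; rewrite fct_sumE ip_mulmxE; apply: eq_bigr => i _.
  by rewrite mulrfctE fct_sumE.
have hi i := is_derive_coord i hu; have hj j := is_derive_coord j hv.
apply: is_derive_eq; rewrite !ip_mulmxE -big_split/=; apply: eq_bigr => i _.
by rewrite fct_sumE addrC; congr (_ + _); rewrite mulrC.
Qed.

Lemma cvg_ip_mulmx k (M : 'M[R]_k) (T : Type) (F : set_system T) {FF : Filter F}
    (u v : T -> 'cV[R]_k) a b :
  u x @[x --> F] --> a -> v x @[x --> F] --> b ->
  ip (u x) (M *m v x) @[x --> F] --> ip a (M *m b).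
Proof.
move=> ua vb; rewrite ip_mulmxE; under eq_cvg do rewrite ip_mulmxE.
have coord (w : T -> 'cV[R]_k) (c : 'cV[R]_k) i : w x @[x --> F] --> c ->
    w x i 0 @[x --> F] --> c i 0.
  move=> wc.
  apply: (@cvg_comp _ _ _ w (fun c : 'cV[R]_k => c i 0) _ (nbhs c)) => //.
  exact: coord_continuous.
apply: cvg_big => [|i _]; first exact: add_continuous.
apply: cvgM; first exact: coord.
apply: cvg_big => [|j _]; first exact: add_continuous.
by apply: cvgM; [exact: cvg_cst|exact: coord].
Qed.

Lemma cV_norm_coord k (v : 'cV[R]_k) i : `|v i 0| <= `|v|.
Proof.
by rewrite [leRHS]/Num.Def.normr/= mx_normrE; exact: (le_bigmax _ _ (i, 0)).
Qed.

(** A nonzero max norm is attained at an entry; [0 <= c] covers the zero norm, including [k = 0]. *)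
Lemma cV_norm_sqr_le k (v : 'cV[R]_k) c :
  (forall i, v i 0 ^+ 2 <= c) -> 0 <= c -> `|v| ^+ 2 <= c.
Proof.
move=> vc c0; have [->|v0] := eqVneq `|v| 0; first by rewrite expr0n.
have [[i j] /= vE] := mx_norm_neq0 v0.
by rewrite [`|v|]vE (ord1 j) real_normK ?num_real.
Qed.

End Calculus.

(** * Exponential decay derived from the dissipation inequality *)

Section ExponentialDecay.
Variables (R : realType) (n : nat) (A B P M : 'M[R]_n).
Variables (Ts eps : R).
Hypothesis (pP : posdefmx P) (pS : posdefmx M).
Hypothesis (Ts_gt0 : 0 < Ts) (eps_gt0 : 0 < eps).
Hypothesis dissip : forall (x y z : 'cV[R]_n) sigma, 0 <= sigma <= Ts + eps ->
  y = A *m x + B *m (x - sigma *: z) ->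
  2 * ip x (P *m y) + (Ts + eps) * ip y (M *m y) + eps * ip x (P *m x)
    <= sigma * ip z (M *m z).

(** Strictly between 0 and [eps]: [sigma] stays within the range of [dissip], and [lambda] exceeds
    1. *)
Let delta := eps / 2.
Let T := Ts + delta.
Let lambda := (Ts + eps) / T.
(** The first bound pays for [rate] times x^T P x, the second for [rate] times the increment term of
    V. *)
Definition rate := Num.min eps ((lambda - 1) / (Ts + eps)).

Let T_gt0 : 0 < T.
Proof. by rewrite addr_gt0// divr_gt0. Qed.

Let lambda_gt1 : 1 < lambda.
Proof.
by rewrite /lambda ltr_pdivlMr// mul1r ltrD2l gtr_pMr// invf_lt1 ?ltr1n.
Qed.

Let lambdaT : lambda * T = Ts + eps.
Proof. by rewrite divfK// gt_eqF. Qed.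

Lemma rate_gt0 : 0 < rate.
Proof. by rewrite lt_min eps_gt0 divr_gt0 ?subr_gt0 ?addr_gt0. Qed.

Let rate_le_eps : rate <= eps.
Proof. by rewrite ge_min lexx. Qed.

Let rate_lambda : rate * (Ts + eps) <= lambda - 1.
Proof. by rewrite -ler_pdivlMr ?addr_gt0// ge_min lexx orbT. Qed.

(** * The Lyapunov function on one sampling interval *)

Section Interval.
Variables (x : R -> 'cV[R]_n) (t0 t1 : R).
Hypothesis t01 : t1 - t0 <= Ts.
Hypothesis cx : {within `[t0, t1], continuous x}.
Hypothesis dx : forall s, t0 < s -> s < t1 ->
  is_derive s 1 x (A *m x s + B *m x t0).

Let W s := ip (x s) (P *m x s).
Let D s := ip (x s - x t0) (M *m (x s - x t0)).
Let sigma s := s - t0 + delta.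
Let V s := W s + lambda * (T / sigma s - 1) * D s.
Let G s := expR (rate * s) * V s.

Let sigma_gt0 s : t0 <= s -> 0 < sigma s.
Proof. by move=> ts; rewrite ltr_wpDl ?subr_ge0// divr_gt0. Qed.

Let sigma_le s : s <= t1 -> sigma s <= T.
Proof. by move=> st; rewrite lerD2r (le_trans _ t01)// lerD2r. Qed.

(** The left side is rate V + V', that is, the derivative of [G] divided by its exponential
    factor. *)
Let decay_ineq y s : t0 <= s -> s <= t1 ->
  y = A *m x s + B *m x t0 ->
  rate * V s + (2 * ip (x s) (P *m y)
    - lambda * (T / sigma s ^+ 2) * D s
    + lambda * (T / sigma s - 1) * (2 * ip (x s - x t0) (M *m y))) <= 0.
Proof.
move=> ts st yE; have s0 := sigma_gt0 ts; have sT := sigma_le st.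
have sn0 : sigma s != 0 by rewrite gt_eqF.
rewrite /V /W /D; set sg := sigma s in s0 sT sn0 *; set a := x s in yE *.
have [z zE] : exists z, a - x t0 = sg *: z.
  by exists (sg^-1 *: (a - x t0)); rewrite scalerA mulfV// scale1r.
have xE : x t0 = a - sg *: z by rewrite -zE subKr.
have := dissip (x := a) (y := y) (z := z) (sigma := sg).
rewrite -xE => /(_ _ yE) h.
have {}h := h _.
have q := posdefmx_ge0 (y - z) pS.
rewrite zE; move: q.
rewrite -!scalemxAr !(ipZl, ipZr) mulmxBr !(ipDl, ipDr, ipNl, ipNr).
rewrite (ip_sym y z pS.1).
have W0 := posdefmx_ge0 a pP; have Z0 := posdefmx_ge0 z pS.
have Y0 := posdefmx_ge0 y pS.
set w := ip a (P *m a) in h W0 *; set zz := ip z (M *m z) in h Z0 *.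
set yy := ip y (M *m y) in h Y0 *; set zy := ip z (M *m y) => q.
have {}h : 2 * ip a (P *m y) + (Ts + eps) * yy + eps * w <= sg * zz.
  apply: h; rewrite ltW//= (le_trans sT)// lerD2l.
  by rewrite ler_piMr ?ltW// invf_lt1 ?ltr1n.
set py := ip a (P *m y) in h *.
(* Since [D s] is sigma^2 z^T S z, all negative powers of sigma cancel. *)
rewrite [X in X <= 0](_ : _ = rate * w + rate * lambda * (T - sg) * sg * zz
  + 2 * py - lambda * T * zz + 2 * lambda * (T - sg) * zy); last by field.
have l0 : 0 < lambda by rewrite (lt_trans _ lambda_gt1).
have r0 := ltW rate_gt0; have rl := rate_lambda.
rewrite -lambdaT in h rl; move: l0 r0 h rl (rate_le_eps) sT.
move: rate (lambda) (T) => r l T' /ltW l0 r0 h rl re sT.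
have Ts0 : 0 <= T' - sg by rewrite subr_ge0.
(* (y - z)^T S (y - z) >= 0 absorbs the cross term z^T S y. *)
have h1 : 0 <= l * (T' - sg) * (yy - 2 * zy + zz).
  by rewrite mulr_ge0 ?(mulr_ge0 l0)//; lra.
have h2 : 0 <= l * sg * yy by rewrite !mulr_ge0// ltW.
have h3 : 0 <= r * l * sg * sg * zz by rewrite !mulr_ge0// ltW.
have h4 : r * w <= eps * w by rewrite ler_wpM2r.
(* Once the cross term is absorbed, - (l - 1) sg zz is left over to pay for the [rate] term. *)
have h5 : r * (l * T') * (sg * zz) <= (l - 1) * (sg * zz).
  by rewrite ler_wpM2r// mulr_ge0// ltW.
lra.
Qed.

Let G_derive s : t0 < s -> s < t1 -> derivable G s 1 /\ derive1 G s <= 0.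
Proof.
move=> ts st; pose y := A *m x s + B *m x t0.
have hx : is_derive s 1 x y := dx ts st.
have sn0 : sigma s != 0 by rewrite gt_eqF// sigma_gt0// ltW.
have hW : is_derive s 1 W (2 * ip (x s) (P *m y)).
  have := is_derive_ip_mulmx P hx hx; rewrite (ip_sym y _ pP.1).
  by move=> h; apply: is_derive_eq; rewrite mulr_natl mulr2n.
have hD : is_derive s 1 D (2 * ip (x s - x t0) (M *m y)).
  have hc : is_derive s 1 (fun r => x r - x t0) y.
    have -> : (fun r => x r - x t0) = x - cst (x t0) by apply/funext.
    by apply: is_derive_eq; rewrite subr0.
  have := is_derive_ip_mulmx M hc hc; rewrite (ip_sym y _ pS.1).
  by move=> h; apply: is_derive_eq; rewrite mulr_natl mulr2n.
have hs : is_derive s 1 sigma 1.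
  have -> : sigma = id + cst (delta - t0).
    by apply/funext => r; rewrite /sigma /cst /= !fctE; lra.
  by apply: is_derive_eq; rewrite addr0.
have hE : is_derive s 1 (fun r => expR (rate * r)) (rate * expR (rate * s)).
  have hr : is_derive s 1 (fun r => rate * r) rate.
    have -> : (fun r => rate * r) = rate \*: id by apply/funext.
    by apply: is_derive_eq; rewrite /GRing.scale/= mulr1.
  have := is_derive1_comp (is_derive_expR (rate * s)) hr.
  by move=> h; apply: is_derive_eq; rewrite mulrC.
have hi := is_deriveV sn0 hs.
pose f r := lambda * (T / sigma r - 1).
have hf : is_derive s 1 f (- (lambda * (T / sigma s ^+ 2))).
  have -> : f = lambda \*: (T \*: (fun r => (sigma r)^-1) - cst 1).
    by apply/funext.
  by apply: is_derive_eq; rewrite /GRing.scale/= subr0 mulr1 !mulrN.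
have hG : is_derive s 1 G (expR (rate * s) * (rate * V s +
    (2 * ip (x s) (P *m y) - lambda * (T / sigma s ^+ 2) * D s
    + lambda * (T / sigma s - 1) * (2 * ip (x s - x t0) (M *m y))))).
  have -> : G = (fun r => expR (rate * r)) * (W + f * D) by apply/funext.
  apply: is_derive_eq; rewrite /GRing.scale/= !fctE /V /f; ring.
split; first exact: ex_derive.
rewrite derive1E derive_val mulr_ge0_le0 ?expR_ge0//.
by rewrite decay_ineq ?ltW.
Qed.

(** Continuity up to the endpoints lets the sign of the derivative inside give monotonicity on the
    closed interval; the shift keeps [sigma] positive at [t0]. *)
Let G_continuous : {within `[t0, t1], continuous G}.
Proof.
have hE : {within `[t0, t1], continuous (fun r => expR (rate * r))}.
  apply: continuous_subspaceT => r; apply: continuous_comp.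
    by apply: cvgM; [exact: cvg_cst|exact: cvg_id].
  exact: continuous_expR.
have hf : {within `[t0, t1], continuous (fun r => lambda * (T / sigma r - 1))}.
  apply: continuous_in_subspaceT => r; rewrite inE/= in_itv/= => /andP[tr _].
  apply: cvgM; first exact: cvg_cst.
  apply: cvgB; last exact: cvg_cst.
  apply: cvgM; first exact: cvg_cst.
  apply: cvgV; first by rewrite gt_eqF// sigma_gt0.
  apply: cvgD; last exact: cvg_cst.
  by apply: cvgB; [exact: cvg_id|exact: cvg_cst].
move=> s; apply: cvgM; first exact: hE.
have hx : x r @[r --> (s : subspace `[t0, t1])] --> x s by exact: cx.
have hc : (x r - x t0) @[r --> (s : subspace `[t0, t1])] --> x s - x t0.
  exact: (cvgB hx (cvg_cst _)).
apply: cvgD; first by exact: (cvg_ip_mulmx hx hx).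
by apply: cvgM; [exact: hf|exact: (cvg_ip_mulmx hc hc)].
Qed.

Lemma interval_decay s : t0 <= s -> s <= t1 ->
  expR (rate * s) * W s <= expR (rate * t0) * W t0.
Proof.
move=> ts st.
have GW : G t0 = expR (rate * t0) * W t0.
  by rewrite /G /V /D subrr ip0l mulr0 addr0.
have WG : expR (rate * s) * W s <= G s.
  rewrite ler_pM2l ?expR_gt0// lerDl mulr_ge0 ?posdefmx_ge0//.
  rewrite mulr_ge0 ?(ltW (lt_trans _ lambda_gt1))// subr_ge0.
  by rewrite ler_pdivlMr ?sigma_gt0// mul1r sigma_le.
rewrite (le_trans WG)// -GW; apply: (@ler0_derive1_le_cc R G t0 t1) => //.
- by move=> r; rewrite in_itv/= => /andP[tr rt]; have [] := G_derive tr rt.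
- by move=> r; rewrite in_itv/= => /andP[tr rt]; have [] := G_derive tr rt.
- by rewrite in_itv/= ts.
- by rewrite in_itv/= lexx (le_trans ts).
Qed.

End Interval.

(** * From one sampling interval to the half-line *)

Lemma sampled_decay t x : sampling_sequence t ->
  (forall k, t k.+1 - t k <= Ts) -> sampled_solution A B t x ->
  forall s, 0 <= s ->
  expR (rate * s) * ip (x s) (P *m x s) <= ip (x 0) (P *m x 0).
Proof.
move=> [t00 tlt tinf] tTs [cx dx].
have t_ge0 k : 0 <= t k.
  by elim: k => [|k IH]; rewrite ?t00// (le_trans IH)// ltW.
have step k s : t k <= s -> s <= t k.+1 ->
    expR (rate * s) * ip (x s) (P *m x s)
      <= expR (rate * t k) * ip (x (t k)) (P *m x (t k)).
  apply: interval_decay => //.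
    apply: continuous_subspaceW cx => r /=; rewrite !in_itv/= => /andP[tr _].
    by rewrite andbT (le_trans (t_ge0 k)).
  by move=> r tr rt; have := dx k r tr rt; rewrite /= subKr.
(* The increment term of V is reset at every [t k], so only the weighted x^T P x is chained. *)
have nodes k : expR (rate * t k) * ip (x (t k)) (P *m x (t k))
    <= ip (x 0) (P *m x 0).
  elim: k => [|k IH]; first by rewrite t00 mulr0 expR0 mul1r.
  by rewrite (le_trans _ IH)// step ?lexx// ltW.
move=> s s0; have /cvgryPgt/(_ s)[N _ /(_ N (leqnn N))/= sN] := tinf.
have [k tk] : exists k, t k <= s < t k.+1.
  elim: N sN => [|N IH] sN; first by move: sN; rewrite t00 ltNge s0.
  by have [/IH//|tN] := ltP s (t N); exists N; rewrite tN.
by move: tk => /andP[tk kt]; rewrite (le_trans (step k s _ _))// ltW.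
Qed.

(** Comparing x^T P x with the squared max norm from both sides turns the decay into [bound], from
    which stability and attraction both follow. *)
Lemma sampled_asymptotically_stable t : sampling_sequence t ->
  (forall k, t k.+1 - t k <= Ts) ->
  asymptotically_stable (sampled_solution A B t).
Proof.
move=> ht tTs.
have [a a0 ha] := posdefmx_coord pP.
have [c c0 hc] : exists2 c, 0 < c & forall v : 'cV[R]_n,
    ip v (P *m v) <= c * `|v| ^+ 2.
  pose b := \sum_i \sum_j `|P i j|.
  have b0 : 0 <= b by do 2!(apply: sumr_ge0 => ? _).
  exists (1 + b); first by rewrite ltr_pwDl.
  move=> v; rewrite mulrDl mul1r ler_wpDl ?sqr_ge0//.
  rewrite ip_mulmxE mulr_suml ler_sum// => i _.
  rewrite mulr_sumr mulr_suml ler_sum// => j _.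
  rewrite (le_trans (ler_norm _))// mulrCA normrM ler_wpM2l// normrM expr2.
  by rewrite ler_pM// cV_norm_coord.
have bound x : sampled_solution A B t x -> forall s, 0 <= s ->
    `|x s| ^+ 2 <= a * c * `|x 0| ^+ 2 * expR (- (rate * s)).
  move=> hx s s0; have := sampled_decay ht tTs hx s0.
  rewrite mulrC -ler_pdivlMr ?expR_gt0// -expRN => h.
  have {}h := le_trans h (ler_wpM2r (expR_ge0 _) (hc _)).
  have rhs0 : 0 <= a * c * `|x 0| ^+ 2 * expR (- (rate * s)).
    by rewrite !mulr_ge0 ?expR_ge0 ?sqr_ge0// ltW.
  apply: cV_norm_sqr_le => // i.
  by rewrite (le_trans (ha _ i))// -2!mulrA ler_pM2l// mulrA.
have stable x : sampled_solution A B t x ->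
    forall e, 0 < e -> forall s, 0 <= s ->
    a * c * `|x 0| ^+ 2 * expR (- (rate * s)) < e ^+ 2 -> `|x s| < e.
  move=> hx e e0 s s0 h; rewrite -(@ltr_pXn2r _ 2) ?nnegrE// ?(ltW e0)//.
  exact: le_lt_trans (bound x hx s s0) h.
split.
(* This radius solves a c d^2 = e^2. *)
- move=> e e0; exists (e / Num.sqrt (a * c)).
    by rewrite divr_gt0// sqrtr_gt0 mulr_gt0.
  move=> x hx xd s s0; apply: (stable x hx) => //.
  have ac : 0 < a * c by rewrite mulr_gt0.
  rewrite (@le_lt_trans _ _ (a * c * `|x 0| ^+ 2))//.
    rewrite ler_piMr ?(mulr_ge0 (ltW ac))// -expR0 ler_expR oppr_le0.
    by rewrite mulr_ge0// ltW// rate_gt0.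
  rewrite mulrC -ltr_pdivlMr// -[a * c]sqr_sqrtr ?(ltW ac)// -expr_div_n.
  by rewrite ltr_pXn2r// ?nnegrE// divr_ge0// ltW.
- move=> x hx; apply/cvgr0Pnorm_lt => e e0.
  have lim : a * c * `|x 0| ^+ 2 * expR (- (rate * s)) @[s --> +oo] --> 0.
    rewrite -[X in _ --> X](mulr0 (a * c * `|x 0| ^+ 2)).
    apply: cvgMr.
    apply: (@cvg_comp _ _ _ (fun s => rate * s) (fun r => expR (- r)) _ +oo).
      exact: gt0_cvgMry rate_gt0 cvg_id.
    exact: cvgr_expR.
  have e2 : 0 < e ^+ 2 by rewrite exprn_gt0.
  near=> s; apply: (stable x hx) => //; near: s.
  move/cvgr0Pnorm_lt : lim => /(_ _ e2); apply: filterS => s.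
  exact: le_lt_trans (ler_norm _).
Unshelve. all: by end_near. Qed.

End ExponentialDecay.

Theorem theorem1 (R : realType) (n m : nat) (hn : (1 <= n)%N) (hm : (1 <= m)%N)
    (Ahat : 'M[R]_n) (Bhat : 'M[R]_(n, m))
    (Abar : 'M[R]_n) (Bbar : 'M[R]_(n, m))
    (hAbar : forall i j, 0 <= Abar i j) (hBbar : forall i j, 0 <= Bbar i j)
    (Ts : R) (hTs : 0 < Ts)
    (Q1 Q2 Q3 Z1 Z2 Z3 Rm : 'M[R]_n) (Y : 'M[R]_(m, n)) (eps1 eps2 : R)
    (hQ1 : posdefmx Q1) (hRm : posdefmx Rm)
    (heps1 : 0 < eps1) (heps2 : 0 < eps2)
    (hlmi1 : negdefmx (lmi1 Ahat Bhat (uncH R n m) (uncE m Abar) (uncF Bbar)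
                         Ts Q1 Q2 Q3 Z1 Z2 Z3 Rm Y eps1))
    (hlmi2 : possemidefmx (lmi2 Bhat (uncH R n m) (uncF Bbar)
                             Q1 Z1 Z2 Z3 Rm Y eps2)) :
  forall t : nat -> R, sampling_sequence t ->
    (forall k, t k.+1 - t k <= Ts) ->
    robustly_asymptotically_stable Ahat Bhat
      (uncH R n m) (uncE m Abar) (uncF Bbar) (Y *m invmx Q1) t.
Proof.
move=> t ht tTs delta d1 /=.
(* The margin [eps], and with it the decay rate, is uniform in [delta]. *)
have [eps eps0 hdiss] := dissipation hTs heps1 heps2 hQ1 hRm hlmi1 hlmi2.
exact: (sampled_asymptotically_stable (posdefmx_inv hQ1) (posdefmx_inv hRm)
          hTs eps0 (hdiss delta d1) ht tTs).
Qed.
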